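(* Let $\xi_1$ be a heavy-tailed random variable. The following are equivalent: (i) There exists (on a suitable probability space) a heavy-tailed random variable $\xi_2$, independent of $\xi_1$, such that $\eta := \min(\xi_1,\xi_2)$ is light-tailed. (ii) $\xi_1$ has a segmented heavy tail.
   Context: All random variables are real-valued. A random variable $\xi$ is heavy-tailed if $\mathbb{E}e^{\lambda\xi}=\infty$ for all $\lambda>0$, and light-tailed if $\mathbb{E}e^{\lambda\xi}<\infty$ for some $\lambda>0$. The cumulative hazard of $\xi$ is $R_\xi(x):=-\log \mathbb{P}(\xi>x)\in[0,\infty]$, $x\in\mathbb{R}$. A segmentation is a sequence $1<s_1<t_1<s_2<t_2<\cdots$ increasing to infinity with $\lim_{i\to\infty} s_i/t_i=0$. A random variable $\xi$ has a segmented heavy tail if it is heavy-tailed and satisfies condition (C): there exist $\gamma>0$ and a segmentation $1<s_1<t_1<s_2<t_2<\cdots$ such that $R_\xi(x)/x\geq\gamma$ for all $x\in[s_i,t_i]$ and all $i=1,2,\dots$. ''On a suitable probability space'' means that the underlying probability space may be replaced by another one carrying a copy of $\xi_1$ with the same distribution. *)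

(* Defs.v *)
From HB Require Import structures.
From mathcomp Require Import all_boot all_order all_algebra.
From mathcomp Require Import all_classical all_reals all_analysis measurable_realfun.

Set Implicit Arguments.
Unset Strict Implicit.
Unset Printing Implicit Defensive.

Import Order.TTheory GRing.Theory Num.Theory.
Import numFieldNormedType.Exports.

Local Open Scope classical_set_scope.
Local Open Scope ring_scope.

Section defs.
Context d (T : measurableType d) (R : realType) (P : probability T R).

(* ['M_P X lambda] is E(exp(lambda X)), with values in [0, +oo]. *)
Definition heavy_tailed (X : {RV P >-> R}) :=
  forall lambda : R, 0 < lambda -> ('M_P X lambda = +oo)%E.

Definition light_tailed (X : {RV P >-> R}) :=
  exists2 lambda : R, 0 < lambda & ('M_P X lambda < +oo)%E.

(* [ccdf X x] is P(X > x), and [lne 0 = -oo], so the hazard is [+oo] where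
   the tail vanishes. *)
Definition cumulative_hazard (X : {RV P >-> R}) (x : R) : \bar R :=
  (- lne (ccdf X x))%E.

Definition independent_RVs (X Y : {RV P >-> R}) :=
  forall A B : set R, measurable A -> measurable B ->
    (P (X @^-1` A `&` Y @^-1` B) = P (X @^-1` A) * P (Y @^-1` B))%E.

End defs.

(* The terms are numbered from 0. *)
Definition segmentation (R : realType) (s t : nat -> R) :=
  [/\ 1 < s 0%N,
      forall i, s i < t i /\ t i < s i.+1,
      s @ \oo --> +oo,
      t @ \oo --> +oo
    & (fun i => s i / t i) @ \oo --> (0 : R)].

Definition conditionC d (T : measurableType d) (R : realType)
    (P : probability T R) (X : {RV P >-> R}) :=
  exists (gamma : R) (s t : nat -> R),
    [/\ 0 < gamma, segmentation s t
      & forall (i : nat) (x : R), s i <= x <= t i ->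
          (gamma%:E <= cumulative_hazard X x / x%:E)%E].

Definition segmented_heavy_tail d (T : measurableType d) (R : realType)
    (P : probability T R) (X : {RV P >-> R}) :=
  heavy_tailed X /\ conditionC X.

(* A measure of the library is a function on all sets whose values off the
   sigma-algebra are unconstrained, so laws are compared on measurable sets. *)
Definition same_distribution d (T : measurableType d) d' (T' : measurableType d')
    (R : realType) (P : probability T R) (P' : probability T' R)
    (X : {RV P >-> R}) (X' : {RV P' >-> R}) :=
  forall A : set R, measurable A -> distribution P X A = distribution P' X' A.

(* Main.v *)
Require Import Defs.
From HB Require Import structures.
From mathcomp Require Import all_boot all_order all_algebra.
From mathcomp Require Import all_classical all_reals all_analysis measurable_realfun.
From mathcomp Require Import lra.

(** Everything is expressed through the tail [ccdf X x = P(X > x)].  A Chernoff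
    bound in one direction and a geometric series in the other show that [X] is
    light-tailed exactly when, for some [gam > 0], one has
    [P(X > x) <= exp(- gam x)] for all large [x] ([light_tailedP]).  Hence [X]
    is heavy-tailed exactly when every such bound fails at arbitrarily large [x]
    ([heavy_tailedP]).  For independent [X] and [Y] the tail of [min(X, Y)] is
    the product of the tails, that is, hazards add ([ccdf_min]).

    From a light minimum to condition (C): suppose [R_X + R_Y >= lam x] for
    large [x], with [Y] heavy-tailed.  Then [R_Y(t) / t] is arbitrarily small at
    arbitrarily large [t], and since [R_Y] is nondecreasing, a single such [t]
    makes [R_Y] small on all of [[0, t]]: if [R_Y(t) <= lam t / (2 K)] then
    [R_Y(x) <= lam x / 2] on [[t / K, t]].  There [X] alone must carry the other
    half of the hazard, [R_X(x) >= lam x / 2].  Letting [K] grow along a sequence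
    of such [t] produces the segmentation ([conditionC_of_light_min]).

    From condition (C) to a light minimum: let [Y] be independent of [X] and take
    the values [t_n], with [P(Y >= t_n) = exp(- gam s_n)] for [n >= 1].  On
    [[t_n, t_(n+1)[] the hazard of [Y] is constantly [gam s_(n+1)].  This is at
    least [gam x] up to [s_(n+1)], and from there on [X] takes over by condition
    (C), so the minimum is light-tailed.  Just before [t_n], however, the hazard
    of [Y] is only [gam s_n], which is negligible against [t_n] because
    [s_n / t_n] tends to 0, so [Y] is heavy-tailed
    ([light_min_of_conditionC]). *)

Set Implicit Arguments.
Unset Strict Implicit.
Unset Printing Implicit Defensive.

Import Order.TTheory GRing.Theory Num.Theory.
Import numFieldNormedType.Exports.

Local Open Scope classical_set_scope.
Local Open Scope ring_scope.

(** * Exponential tails *)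

Section tails.
Context d (T : measurableType d) (R : realType) (P : probability T R).
Implicit Types X Y : {RV P >-> R}.

Lemma measurable_RV_preimage X (A : set R) :
  measurable A -> measurable (X @^-1` A).
Proof. by move=> mA; rewrite -[_ @^-1` _]setTI; exact: measurable_funPT. Qed.

Lemma ccdf_le1 X x : (ccdf X x <= 1)%E.
Proof. exact: probability_le1. Qed.

(** The form in which condition (C) is used.  The conventions [ln 0 = -oo] and
    [-(-oo) = +oo] make it hold also where the tail vanishes. *)
Lemma le_cumulative_hazard X (gam x : R) : 0 < x ->
  (gam%:E <= cumulative_hazard X x / x%:E)%E =
  (ccdf X x <= (expR (- (gam * x)))%:E)%E.
Proof.
move=> x0; rewrite /cumulative_hazard inver gt_eqF// lee_pdivlMr//.
rewrite -EFinM leeNr -EFinN -lee_expeR lneK//=.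
by rewrite in_itv/= measure_ge0 leey.
Qed.

(** Rounding [X] to integers replaces the integral of [exp(lam X)] by the series
    of the [exp(lam (n + 2)) P(X > n)], which converges geometrically as soon as
    [lam < gam]. *)
Lemma light_tailed_of_exp_tail X (gam x0 : R) : 0 < gam ->
  (forall x, x0 <= x -> (ccdf X x <= (expR (- (gam * x)))%:E)%E) ->
  light_tailed X.
Proof.
move=> gam0 tailX; pose lam := gam / 2; have lam0 : 0 < lam by rewrite divr_gt0.
(* With the constant C the bound also holds below x0, where only P <= 1 is
   known. *)
pose C := expR (gam * Num.max 0 x0).
have tailXn (n : nat) : (ccdf X n%:R <= (C * expR (- (gam * n%:R)))%:E)%E.
  rewrite -expRD; have [x0n|nx0] := leP x0 n%:R.
    apply: (le_trans (tailX _ x0n)); rewrite lee_fin ler_expR lerDr.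
    by rewrite mulr_ge0 ?le_max ?lexx// ltW.
  apply: (le_trans (ccdf_le1 _ _)); rewrite lee_fin -[leLHS]expR0 ler_expR.
  rewrite -mulrN -mulrDr mulr_ge0 ?(ltW gam0)// subr_ge0.
  by rewrite le_max (ltW nx0) orbT.
exists lam => //; rewrite /mmt_gen_fun unlock.
pose f n w := ((expR (lam * (n%:R + 2)))%:E *
               (\1_(X @^-1` `]n%:R, +oo[) w)%:E)%E.
have mX (n : nat) : measurable (X @^-1` `]n%:R, +oo[).
  exact: measurable_RV_preimage.
have f_ge0 n w : (0 <= f n w)%E.
  by rewrite mule_ge0// lee_fin ?expR_ge0// indicE ler0n.
have mf n : measurable_fun setT (f n).
  apply: measurable_funeM; apply/measurable_EFinP; exact: measurable_indic.
have intf n : (\int[P]_w f n w =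
    (expR (lam * (n%:R + 2)))%:E * ccdf X n%:R)%E.
  rewrite ge0_integralZl_EFin// ?expR_ge0//.
  - by rewrite integral_indic// setIT.
  - by apply/measurable_EFinP; exact: measurable_indic.
have le_f w : ((expR (X w * lam))%:E <= (expR lam)%:E + \sum_(n <oo) f n w)%E.
  have [X1|X1] := ltP (X w) 1.
    rewrite -[leLHS]adde0 leeD ?nneseries_ge0// lee_fin ler_expR.
    by rewrite -[leRHS]mul1r ler_pM2r// ltW.
  (* Truncating X - 1 rather than X makes n < X strict, also at integers. *)
  have /truncn_itv/andP[nX Xn] : 0 <= X w - 1 by rewrite subr_ge0.
  set n := Num.trunc _ in nX Xn.
  rewrite -[leLHS]add0e leeD ?lee_fin ?expR_ge0//.
  apply: le_trans (nneseries_lim_ge n.+1 (fun k _ _ => f_ge0 k w)).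
  rewrite big_nat_recr//= -[leLHS]add0e leeD ?sume_ge0//.
  rewrite /f indicE mem_set/= ?mule1; last first.
    by rewrite in_itv/= andbT; lra.
  rewrite lee_fin ler_expR mulrC ler_pM2l//.
  by rewrite -natr1 in Xn; lra.
have cvgS : (\sum_(n <oo) ((C * expR gam) * expR (- lam) ^+ n)%:E < +oo)%E.
  have q1 : `|expR (- lam)| < 1.
    by rewrite ger0_norm ?expR_ge0// expR_lt1 oppr_lt0.
  have cvgG := @is_cvg_geometric_series _ (C * expR gam) _ q1.
  rewrite (_ : limn _ =
    (limn (series (geometric (C * expR gam) (expR (- lam)))))%:E) ?ltry//.
  rewrite -EFin_lim//; apply/congr_lim/funext => n /=.
  by rewrite /series/= -sumEFin.
apply: (@le_lt_trans _ _ ((expR lam)%:E +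
    \sum_(n <oo) ((C * expR gam) * expR (- lam) ^+ n)%:E)%E); last first.
  by rewrite lte_add_pinfty ?ltry.
apply: (@le_trans _ _ (\int[P]_w ((expR lam)%:E + \sum_(n <oo) f n w))%E).
  apply: ge0_le_integral => //=.
  - apply/measurable_EFinP; apply: measurableT_comp => //.
    exact: measurable_funM.
  - by apply: emeasurable_funD => //; exact: ge0_emeasurable_sum.
rewrite ge0_integralD//=; last 2 first.
- by move=> w _; exact: nneseries_ge0.
- exact: ge0_emeasurable_sum.
rewrite integral_cst// [X in (_ * X + _)%E](@probability_setT _ _ _ P) mule1.
rewrite leeD2l//.
rewrite integral_nneseries//.
apply: lee_nneseries => [n _ _|n _]; first exact: integral_ge0.
rewrite intf; apply: (@le_trans _ _ ((expR (lam * (n%:R + 2)))%:E *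
    (C * expR (- (gam * n%:R)))%:E)%E).
  by rewrite lee_pmul2l// lte_fin expR_gt0.
rewrite -EFinM lee_fin mulrCA -mulrA ler_pM2l ?expR_gt0//.
rewrite -expRM_natl -!expRD ler_expR -mulr_natl /lam; lra.
Qed.

(** The bound carries no multiplicative constant: the factor [E exp(lam X)] of
    Chernoff's inequality is absorbed for large [x] by halving [lam]. *)
Lemma light_tailedP X : light_tailed X <->
  exists gam x0 : R, 0 < gam /\
    forall x, x0 <= x -> (ccdf X x <= (expR (- (gam * x)))%:E)%E.
Proof.
split=> [[lam lam0 mX]|[gam [x0 [gam0 tailX]]]]; last first.
  exact: light_tailed_of_exp_tail tailX.
have M0 : (0 <= 'M_P X lam)%E.
  by rewrite expectation_ge0// => w; exact: expR_ge0.
have Mfin : 'M_P X lam \is a fin_num by rewrite ge0_fin_numE.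
set M := fine ('M_P X lam).
exists (lam / 2), (2 / lam * M); split=> [|x Mx]; first by rewrite divr_gt0.
apply: (@le_trans _ _ (M * expR (- (lam * x)))%:E).
  rewrite EFinM /M fineK//; apply: le_trans (chernoff X x lam0).
  rewrite /ccdf /distribution /pushforward; apply: le_measure; rewrite ?inE.
  - exact: measurable_RV_preimage.
  - rewrite (_ : [set w | _] = X @^-1` `[x, +oo[).
      exact: measurable_RV_preimage.
    by apply/seteqP; split=> w /=; rewrite in_itv/= andbT.
  - by move=> w /=; rewrite in_itv/= andbT => /ltW.
rewrite lee_fin -[leRHS]mul1r.
have -> : - (lam * x) = - (lam / 2 * x) + - (lam / 2 * x) by lra.
rewrite expRD mulrA ler_pM2r ?expR_gt0// expRN ler_pdivrMr ?expR_gt0// mul1r.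
(* It remains to see M <= exp(lam x / 2), which follows from 1 + y <= exp y and
   the choice of the threshold 2 M / lam. *)
apply: (@le_trans _ _ (lam / 2 * x)).
  rewrite -ler_pdivrMl ?divr_gt0//; apply: le_trans Mx.
  by rewrite invf_div.
apply: le_trans (expR_ge1Dx _); lra.
Qed.

Lemma heavy_tailedP X : heavy_tailed X <->
  forall gam x0 : R, 0 < gam ->
    exists2 x, x0 <= x & ((expR (- (gam * x)))%:E < ccdf X x)%E.
Proof.
split=> [hX gam x0 gam0|hX lam lam0].
  apply: contrapT => nex.
  have [lam lam0] : light_tailed X.
    apply/light_tailedP; exists gam, x0; split=> // x x0x.
    by rewrite leNgt; apply/negP => ?; apply: nex; exists x.
  by rewrite hX// ltxx.
apply/eqP; rewrite -leye_eq leNgt; apply/negP => Mlt.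
have /light_tailedP[gam [x0 [gam0 tailX]]] : light_tailed X by exists lam.
have [x x0x] := hX gam x0 gam0.
by rewrite ltNge tailX.
Qed.

Lemma ccdf_min X Y : independent_RVs X Y -> forall x,
  ccdf (X \min Y : {RV P >-> R}) x = (ccdf X x * ccdf Y x)%E.
Proof.
move=> indep x; rewrite /ccdf /distribution /pushforward -indep//; congr (P _).
by apply/seteqP; split=> w /=; rewrite !in_itv/= !andbT lt_min => /andP.
Qed.

End tails.

(** * Condition (C) from a light-tailed minimum *)

Section segments.
Context d (T : measurableType d) (R : realType) (P : probability T R).
Implicit Types X Y : {RV P >-> R}.

(** Segments on which the hazard of [X] is large, arbitrarily long in ratio and
    starting arbitrarily far out, can be strung together into a segmentation by
    choosing them one after the other. *)
Lemma conditionC_of_long_segments X (gam : R) : 0 < gam ->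
  (forall (k : nat) (b : R), exists s, b < s /\
     forall x, s <= x <= k.+2%:R * s ->
       (ccdf X x <= (expR (- (gam * x)))%:E)%E) ->
  conditionC X.
Proof.
move=> gam0 long.
have /choice[f hf] : forall kb : nat * R, exists s, kb.2 < s /\
    forall x, s <= x <= kb.1.+2%:R * s ->
      (ccdf X x <= (expR (- (gam * x)))%:E)%E by move=> [k b]; exact: long.
(* The k-th segment is [s k, (k + 2) s k]; it starts after the previous one
   ends, and after k so that s diverges. *)
pose s := fix s k := if k is k'.+1
  then f (k, Num.max k%:R (k'.+2%:R * s k')) else f (0%N, 1).
have s_gt k : k%:R < s k /\ 1 < s k.
  case: k => [|k] /=.
    by have [/= h _] := hf (0%N, 1); split=> //; exact: lt_trans h.
  have [+ _] := hf (k.+1, Num.max k.+1%:R (k.+2%:R * s k)).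
  rewrite gt_max => /andP[ks _]; split=> //.
  by apply: le_lt_trans ks; rewrite ler1n.
have s0 k : 0 < s k by have [_] := s_gt k; exact: lt_trans.
have st k : s k < k.+2%:R * s k.
  by rewrite -[ltLHS]mul1r ltr_pM2r// ltr1n.
have cvgs : s @ \oo --> +oo.
  apply/cvgryPge => A; near=> n; apply: le_trans (ltW (s_gt n).1).
  by near: n; exact: nbhs_infty_ger.
exists gam, s, (fun k => k.+2%:R * s k); split=> //.
  split=> //.
  - by have [] := s_gt 0%N.
  - move=> k; split=> //=.
    have [+ _] := hf (k.+1, Num.max k.+1%:R (k.+2%:R * s k)).
    by rewrite gt_max => /andP[].
  - apply/cvgryPge => A; near=> n; apply: le_trans (ltW (st n)).
    by near: n; move/cvgryPge: cvgs; exact.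
  - rewrite (_ : (fun k => _) = (fun k => @harmonic R k.+1)).
      by rewrite (cvg_shiftS (@harmonic R)); exact: cvg_harmonic.
    apply/funext => k /=; rewrite invfM mulrCA mulfV ?mulr1//.
    by rewrite gt_eqF.
move=> k x sxt; have x0 : 0 < x by case/andP: sxt => /(lt_le_trans (s0 k)).
rewrite le_cumulative_hazard//; case: k sxt => [|k] sxt.
  exact: (hf (0%N, 1)).2.
exact: (hf (k.+1, Num.max k.+1%:R (k.+2%:R * s k))).2.
Unshelve. all: end_near. Qed.

(** One point [t] at which the tail of [Y] is large forces it to be large on the
    whole of [[t / K, t]], by monotonicity; there the decay of the minimum has to
    come from [X]. *)
Lemma conditionC_of_light_min X Y : heavy_tailed Y -> independent_RVs X Y ->
  light_tailed (X \min Y : {RV P >-> R}) -> conditionC X.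
Proof.
move=> /heavy_tailedP hY indep /light_tailedP[lam [x0 [lam0 tailXY]]].
apply: (@conditionC_of_long_segments _ (lam / 2)); first by rewrite divr_gt0.
move=> k b; set K : R := k.+2%:R; have K0 : 0 < K by [].
pose del := lam / 2 / K; pose c := Num.max b x0 + 1.
have [t ct tailY] : exists2 t, K * c <= t &
    ((expR (- (del * t)))%:E < ccdf Y t)%E by apply: hY; rewrite !divr_gt0.
have cs : c <= t / K by rewrite ler_pdivlMr// mulrC.
have [bs x0s] : b < t / K /\ x0 <= t / K.
  have : Num.max b x0 < t / K by apply: lt_le_trans cs; rewrite ltrDl.
  by rewrite gt_max => /andP[-> /ltW].
exists (t / K); split=> // x; rewrite [K * _]mulrC divfK ?gt_eqF// => /andP[sx xt].
(* As t / K <= x, the bound exp(- del t) at t is at least exp(- lam x / 2). *)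
have Yx : ((expR (- (lam / 2 * x)))%:E <= ccdf Y x)%E.
  apply: le_trans (ccdf_nonincreasing Y xt).
  apply: le_trans (ltW tailY); rewrite lee_fin ler_expR lerN2 /del.
  by rewrite -mulrA (mulrC _ t) ler_pM2l// divr_gt0.
have /tailXY := le_trans x0s sx; rewrite ccdf_min// => XYx.
have e0 : 0 < expR (- (lam / 2 * x)) := expR_gt0 _.
rewrite -(@lee_pmul2r _ (expR (- (lam / 2 * x)))%:E)//.
apply: (le_trans (lee_wpmul2l _ Yx)); first exact: measure_ge0.
apply: (le_trans XYx); rewrite -EFinM -expRD lee_fin ler_expR; lra.
Qed.

End segments.

(** * An independent partner for a tail satisfying condition (C) *)

(** The weight of [n] is [a n - a n.+1], so the tail sums telescope. *)
Lemma nat_probability_of_tails (R : realType) (a : nat -> R) :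
  a 0%N = 1 -> (forall n, a n.+1 <= a n) -> a @ \oo --> (0 : R) ->
  exists Q : probability nat R, forall i, Q [set n | (i <= n)%N] = (a i)%:E.
Proof.
move=> a0 a_ni a_cvg0.
have q_ge0 n : 0 <= a n - a n.+1 by rewrite subr_ge0.
pose m n : {measure set nat -> \bar R} := mscale (NngNum (q_ge0 n)) \d_n.
have mE n i : m n [set k | (i <= k)%N] =
    ((a n - a n.+1)%:E * (i <= n)%N%:R%:E)%E.
  rewrite [LHS](_ : _ = ((a n - a n.+1)%:E * \d_n [set k | (i <= k)%N])%E)//.
  rewrite diracE; have [ni|ni] := boolP (i <= n)%N; first by rewrite mem_set.
  by rewrite memNset//=; exact/negP.
pose mu := mseries m 0.
have muE i : mu [set n | (i <= n)%N] = (a i)%:E.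
  rewrite /mu /mseries; apply/cvg_lim => //.
  rewrite -(cvg_shiftn i).
  rewrite (_ : (fun n => _) = (fun n => (a i - a (n + i)%N)%:E)).
    apply/cvg_EFin; first exact: nearW.
    rewrite -[X in _ --> X]subr0; apply: cvgB; first exact: cvg_cst.
    by rewrite (cvg_shiftn i).
  apply/funext; elim=> [|n IH].
    rewrite add0n subrr big_nat big1// => k /andP[_ ki].
    by rewrite mE leqNgt ki mule0.
  rewrite addSn big_nat_recr//= IH mE leq_addl mule1 -EFinD.
  by congr EFin; lra.
have mu1 : mu setT = 1%E.
  by rewrite -a0 -muE; congr mu; apply/seteqP; split.
pose muM : {measure set nat -> \bar R} := mu.
by exists (HB.pack_for (probability nat R) (Measure.sort muM)
  (Measure_isProbability.Build _ _ _ mu mu1)).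
Qed.

(** The product space carries a copy of [X] together with an independent discrete
    random variable [t_N], where [N] has law [Q]. *)
Lemma independent_nat_extension d (T : measurableType d) (R : realType)
    (P : probability T R) (X : {RV P >-> R}) (Q : probability nat R)
    (t : nat -> R) :
  exists (d' : measure_display) (T' : measurableType d')
         (P' : probability T' R) (X' Y : {RV P' >-> R}),
    [/\ same_distribution X X', independent_RVs X' Y
      & forall x, ccdf Y x = Q [set n | x < t n]].
Proof.
pose P' : probability _ R := (P \x Q)%E.
have mX' : measurable_fun [set: T * nat] (X \o fst) by exact: measurableT_comp.
have mY : measurable_fun [set: T * nat] (t \o snd) by exact: measurableT_comp.
pose X' := HB.pack_for {RV P' >-> R} (X \o fst)
  (isMeasurableFun.Build _ _ _ _ _ mX').
pose Y := HB.pack_for {RV P' >-> R} (t \o snd)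
  (isMeasurableFun.Build _ _ _ _ _ mY).
have PX' (A : set R) : measurable A -> P' (X' @^-1` A) = P (X @^-1` A).
  move=> mA; rewrite (_ : _ @^-1` _ = (X @^-1` A) `*` setT); last first.
    by apply/seteqP; split=> [w|w []].
  rewrite [LHS]product_measure1E//; last exact: measurable_RV_preimage.
  by rewrite [X in (_ * X)%E](@probability_setT _ _ _ Q) mule1.
have PY (B : set R) : P' (Y @^-1` B) = Q (t @^-1` B).
  rewrite (_ : _ @^-1` _ = setT `*` (t @^-1` B)); last first.
    by apply/seteqP; split=> [w|w []].
  rewrite [LHS]product_measure1E//.
  by rewrite [X in (X * _)%E](@probability_setT _ _ _ P) mul1e.
exists _, _, P', X', Y; split=> [A mA|A B mA mB|x].
- by rewrite /distribution /pushforward PX'.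
- rewrite PX'// PY -product_measure1E//; exact: measurable_RV_preimage.
- rewrite /ccdf /distribution /pushforward PY; congr (Q _).
  by apply/seteqP; split=> n /=; rewrite in_itv/= andbT.
Qed.

Lemma segmentation_t_le (R : realType) (s t : nat -> R) :
  segmentation s t -> {homo t : m n / (m <= n)%N >-> m <= n}.
Proof.
case=> _ st _ _ _; apply: homo_leq => [//|x y z|n]; first exact: le_trans.
exact: ltW (lt_trans (st n).2 (st n.+1).1).
Qed.

Lemma segmentation_interval (R : realType) (s t : nat -> R) (x : R) :
  segmentation s t -> t 0%N <= x -> exists n, t n <= x < t n.+1.
Proof.
move=> [_ _ _ tcvg _] t0x.
have ex : exists n, x < t n.
  have /cvgryPgt/(_ x)[N _ tN] := tcvg.
  by exists N; exact: tN N (leqnn N).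
case: (ex_minnP ex) => -[|n] xtn minn; first by rewrite ltNge t0x in xtn.
exists n; rewrite xtn andbT leNgt; apply/negP => /minn.
by rewrite ltnn.
Qed.

(** The random variable [Y] keeps the hazard [gam s_(n+1)] from [t_n] to
    [t_(n+1)]: enough for the minimum outside the segments, where nothing is
    known about [X], and too little at the end of each segment for [Y] to be
    light-tailed. *)
Lemma light_min_of_conditionC d (T : measurableType d) (R : realType)
    (P : probability T R) (X : {RV P >-> R}) : conditionC X ->
  exists (d' : measure_display) (T' : measurableType d')
          (P' : probability T' R) (X' Y : {RV P' >-> R}),
     [/\ same_distribution X X', heavy_tailed Y, independent_RVs X' Y
       & light_tailed (X' \min Y : {RV P' >-> R})].
Proof.
move=> [gam [s [t [gam0 seg tailX]]]].
have [s0_gt1 st scvg tcvg ratio] := seg.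
have s_lt n : s n < s n.+1 := lt_trans (st n).1 (st n).2.
have s_gt1 n : 1 < s n by elim: n => // n IH; exact: lt_trans (s_lt n).
have s_gt0 n : 0 < s n := lt_trans ltr01 (s_gt1 n).
have t_gt0 n : 0 < t n := lt_trans (s_gt0 n) (st n).1.
(* The total mass has to be 1, so the hazard before t 0 is 0 rather than
   gam * s 0; the light tail of the minimum is only tested from t 0 on. *)
pose a n := expR (- (gam * (if n is 0%N then 0 else s n))).
have a_ge n : expR (- (gam * s n)) <= a n.
  by rewrite /a ler_expR lerN2 ler_pM2l//; case: n => [|//]; exact: ltW.
have [Q QE] : exists Q : probability nat R,
    forall i, Q [set n | (i <= n)%N] = (a i)%:E.
  apply: nat_probability_of_tails => [|n|].
  - by rewrite /a mulr0 oppr0 expR0.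
  - rewrite /a ler_expR lerN2 ler_pM2l//; case: n => [|n]; exact: ltW.
  - rewrite -cvg_shiftS.
    have gs : gam * s n.+1 @[n --> \oo] --> +oo.
      apply/cvgryPge => A; near=> n; rewrite -ler_pdivrMl//.
      by near: n; move: scvg; rewrite -(cvg_shiftS s) => /cvgryPge; exact.
    exact: cvg_comp gs (@cvgr_expR R).
have [d' [T' [P' [X' [Y [XX' indep ccdfY]]]]]] :=
  independent_nat_extension X Q t.
exists d', T', P', X', Y; split=> //.
- apply/heavy_tailedP => del x0 del0.
  have [n [rn x0n]] : exists n, s n / t n < del / (2 * gam) /\ 2 * x0 <= t n.
    have c0 : 0 < del / (2 * gam) by rewrite divr_gt0// mulr_gt0.
    have : \forall n \near \oo,
        s n / t n < del / (2 * gam) /\ 2 * x0 <= t n.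
      by near=> n; split; near: n; [exact: cvgr_lt ratio _ c0 | exact: cvgry_ge].
    by case=> N _ h; exists N; exact: h N (leqnn N).
  (* Any point below t n and proportional to it would do, since s n / t n -> 0. *)
  exists (t n / 2); first by rewrite ler_pdivlMr// mulrC.
  apply: (@lt_le_trans _ _ (a n)%:E).
    rewrite lte_fin; apply: lt_le_trans (a_ge n).
    rewrite ltr_expR ltrN2.
    move: rn; rewrite ltr_pdivrMr// mulrAC ltr_pdivlMr ?mulr_gt0//; lra.
  rewrite -QE ccdfY; apply: le_measure; rewrite ?inE// => k /= nk.
  apply: lt_le_trans (segmentation_t_le seg nk); rewrite ltr_pdivrMr//.
  by have := t_gt0 n; lra.
- apply/light_tailedP; exists gam, (t 0%N); split=> // x t0x.
  have [n /andP[tnx xtn]] := segmentation_interval seg t0x.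
  have -> : ccdf (X' \min Y : {RV P' >-> R}) x = (ccdf X x * (a n.+1)%:E)%E.
    rewrite ccdf_min//; congr (_ * _)%E; first exact/esym/XX'.
    rewrite ccdfY -QE; congr (Q _); apply/seteqP; split=> k /=.
      move=> xtk; rewrite ltnNge; apply/negP => /(segmentation_t_le seg).
      by move=> /le_trans/(_ tnx); rewrite leNgt xtk.
    by move=> /(segmentation_t_le seg); exact: lt_le_trans.
  (* Inside the segment X provides the decay, before it Y does. *)
  have [sx|xs] := leP (s n.+1) x.
    apply: (@le_trans _ _ (ccdf X x)).
      rewrite -[leRHS]mule1 lee_wpmul2l ?measure_ge0// lee_fin -expR0 ler_expR.
      by rewrite oppr_le0 mulr_ge0 ?ltW.
    rewrite -le_cumulative_hazard; last exact: lt_le_trans t0x.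
    by apply: (tailX n.+1); rewrite sx ltW.
  apply: (@le_trans _ _ (a n.+1)%:E).
    by rewrite -[leRHS]mul1e lee_wpmul2r ?lee_fin ?expR_ge0 ?ccdf_le1.
  by rewrite lee_fin ler_expR lerN2 ler_pM2l// ltW.
Unshelve. all: end_near. Qed.

(** * The equivalence *)

Theorem theorem1p4 (R : realType) (d : measure_display) (T : measurableType d)
    (P : probability T R) (xi1 : {RV P >-> R}) (hxi1 : heavy_tailed xi1) :
  (exists (d' : measure_display) (T' : measurableType d')
          (P' : probability T' R) (xi1' xi2 : {RV P' >-> R}),
     [/\ same_distribution xi1 xi1', heavy_tailed xi2,
         independent_RVs xi1' xi2
       & light_tailed (xi1' \min xi2 : {RV P' >-> R})])
  <-> segmented_heavy_tail xi1.
Proof.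
split=> [[d' [T' [P' [X [Y [XX hY indep light]]]]]]|[_ C]]; last first.
  exact: light_min_of_conditionC.
split=> //; have := conditionC_of_light_min hY indep light.
move=> [gam [s [t [gam0 seg tailX]]]]; exists gam, s, t; split=> // i x sxt.
rewrite /cumulative_hazard (_ : ccdf xi1 x = ccdf X x); first exact: tailX i x sxt.
exact: XX.
Qed.
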